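(* Let $k\ge 1$ and let $\eta_1,\dots,\eta_{k+1}\in S^2$ be chosen so that the $(k+1)\times(k+1)$ matrix $G$ with entries $$G_{ij}=(k+1)\,C_k^{1/2}(\langle\eta_i,\eta_j\rangle)+(\eta_i\wedge\eta_j)\,C_{k-1}^{3/2}(\langle\eta_i,\eta_j\rangle)\in\mathbb{R}_3^+$$ is positive definite. Let $A$ be the $(k+1)\times(k+1)$ matrix with entries in $\mathbb{R}_3^+$ given by $$A=\tau^{-1}\Big(\chi^{-1}\big((\chi(\tau(G)))^{-1/2}\big)\Big).$$ Then $A^{\ast}GA=I_{k+1}$.
   Context: $\mathbb{R}_m$ is the real Clifford algebra generated by $e_1,\dots,e_m$ with $e_j^2=-1$, $e_ie_j=-e_je_i$ for $i\neq j$; $e_{ij}=e_ie_j$. Conjugation is the real-linear anti-automorphism with $\overline{e_j}=-e_j$. $\mathbb{R}_3^+=\mathrm{span}_{\mathbb{R}}\{1,e_{12},e_{13},e_{23}\}$ is the even subalgebra of $\mathbb{R}_3$. A point $x=(x_1,x_2,x_3)\in\mathbb{R}^3$ is identified with $\sum_j x_je_j$; $\langle x,y\rangle=\sum_j x_jy_j$ is the Euclidean inner product and $x\wedge y=\sum_{i<j}e_{ij}(x_iy_j-x_jy_i)$. $C_n^{\mu}$ is the Gegenbauer polynomial of degree $n$ with parameter $\mu$. $S^2$ is the unit sphere in $\mathbb{R}^3$. For a matrix $B$ over $\mathbb{R}_3^+$ or $\mathbb{R}_2$, $B^\ast$ is the conjugate transpose. A self-adjoint $n\times n$ matrix $B$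 over such an algebra is positive definite if $a^\ast Ba>0$ for every nonzero column vector $a$ of length $n$ with entries in the algebra. $\tau:\mathbb{R}_3^+\to\mathbb{R}_2$ is the $\ast$-isomorphism $\tau(x_0+x_{12}e_{12}+x_{13}e_{13}+x_{23}e_{23})=x_0+x_{12}e_{12}+x_{13}e_2-x_{23}e_1$, applied entrywise to matrices. $\mathbb{H}=\mathbb{R}_2$ is the algebra of quaternions and $\mathbb{H}_e=\mathrm{span}_{\mathbb{R}}\{1,e_{12}\}\cong\mathbb{C}$ (with $e_{12}\leftrightarrow i$). Each $B\in M_{n\times n}(\mathbb{H})$ decomposes uniquely as $B=B_1+B_2e_2$ with $B_1,B_2\in M_{n\times n}(\mathbb{H}_e)\cong M_{n\times n}(\mathbb{C})$, and its complex adjoint is $$\chi(B)=\begin{bmatrix}B_1&B_2\\-\overline{B_2}&\overline{B_1}\end{bmatrix}\in M_{2n\times 2n}(\mathbb{C}).$$ $\chi^{-1}$ denotes the inverse of $\chi$ on its image, and $M^{-1/2}$ denotes the inverse of the positive square root of a positive definite Hermitian complex matrix $M$. *)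

(* Defs.v *)
From HB Require Import structures.
From mathcomp Require Import all_boot all_order all_algebra.
From mathcomp Require Import ring.
From mathcomp Require Import sesquilinear spectral complex.
From mathcomp Require Import boolp reals.

Set Implicit Arguments.
Unset Strict Implicit.
Unset Printing Implicit Defensive.

Import Order.TTheory GRing.Theory Num.Theory.
Local Open Scope ring_scope.
Local Open Scope sesquilinear_scope.

Section CliffordSign.
Variables (R : comNzRingType) (m : nat).
Implicit Types A B C : {set 'I_m}.

Definition symdiff A B : {set 'I_m} := [set i | (i \in A) (+) (i \in B)].

(* The sign in e_A e_B = csign A B e_(symdiff A B), for increasing products
   e_A: one -1 for each swap (j < i) and one for each square (j = i). *)
Definition csign A B : R :=
  (-1) ^+ (\sum_(i in A) \sum_(j in B) (j <= i)%N).

Lemma symdiffA : associative symdiff.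
Proof. by move=> A B C; apply/setP=> i; rewrite !inE addbA. Qed.

Lemma symdiffC : commutative symdiff.
Proof. by move=> A B; apply/setP=> i; rewrite !inE addbC. Qed.

Lemma symdiff0s : left_id set0 symdiff.
Proof. by move=> A; apply/setP=> i; rewrite !inE. Qed.

Lemma symdiffs0 : right_id set0 symdiff.
Proof. by move=> A; rewrite symdiffC symdiff0s. Qed.

Lemma symdiffss A : symdiff A A = set0.
Proof. by apply/setP=> i; rewrite !inE addbb. Qed.

Lemma csignDl A B C : csign (symdiff A B) C = csign A C * csign B C.
Proof.
rewrite /csign -!prodrXr !(big_mkcond (fun i => i \in _)) -big_split /=.
apply: eq_bigr => i _; rewrite !inE.
by case: (i \in A); case: (i \in B);
  rewrite /= ?mulr1 ?mul1r // -exprD addnn -muln2 exprM sqrr_sign.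
Qed.

Lemma csignE A B : csign A B = \prod_(j in B) (-1) ^+ (\sum_(i in A) (j <= i)%N).
Proof. by rewrite /csign exchange_big prodrXr. Qed.

Lemma csignDr A B C : csign C (symdiff A B) = csign C A * csign C B.
Proof.
rewrite !csignE !(big_mkcond (fun i => i \in _)) -big_split /=.
apply: eq_bigr => i _; rewrite !inE.
by case: (i \in A); case: (i \in B);
  rewrite /= ?mulr1 ?mul1r // -exprD addnn -muln2 exprM sqrr_sign.
Qed.

Lemma csign0s A : csign set0 A = 1.
Proof. by rewrite /csign big_set0. Qed.

Lemma csigns0 A : csign A set0 = 1.
Proof. by rewrite csignE big_set0. Qed.

Lemma csignK A B : csign A B * csign A B = 1.
Proof. by rewrite -expr2 sqrr_sign. Qed.

End CliffordSign.

(* R_m: the coefficient at A is that of e_A, the increasing product of the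
   generators with index in A. Indices start at 0: gen 0 is e_1. *)
Definition clifford (R : comNzRingType) (m : nat) := {ffun {set 'I_m} -> R^o}.

HB.instance Definition _ (R : comNzRingType) (m : nat) :=
  GRing.Lmodule.copy (clifford R m) {ffun {set 'I_m} -> R^o}.

Section Clifford.
Variables (R : comNzRingType) (m : nat).
Local Notation Cl := (clifford R m).
Implicit Types (x y z : Cl) (A B : {set 'I_m}).

Definition coef A x : R := (x : {ffun {set 'I_m} -> R^o}) A.

Definition blade A : Cl := [ffun B => (B == A)%:R].

Definition gen (i : 'I_m) : Cl := blade [set i].

Definition clmul x y : Cl :=
  \sum_A \sum_B (coef A x * coef B y * csign R A B) *: blade (symdiff A B).

Definition clconj x : Cl := \sum_A (coef A x * csign R A A) *: blade A.

Fact coef_is_linear A : linear_for *%R (coef A).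
Proof. by move=> a x y; rewrite /coef !ffunE. Qed.

HB.instance Definition _ A :=
  GRing.isLinear.Build R Cl R *%R (coef A) (coef_is_linear A).

Lemma coef_blade A B : coef A (blade B) = (A == B)%:R.
Proof. by rewrite /coef ffunE. Qed.

Lemma cliffordP x y : (forall A, coef A x = coef A y) <-> x = y.
Proof. by split=> [h|->//]; apply/ffunP. Qed.

Lemma cliffordE x : x = \sum_A coef A x *: blade A.
Proof.
apply/cliffordP => A; rewrite raddf_sum (bigD1 A) //= big1 ?addr0.
  by rewrite linearZ /= coef_blade eqxx mulr1.
by move=> B; rewrite linearZ /= coef_blade eq_sym => /negPf->; rewrite mulr0.
Qed.

Lemma clifford_ex x : exists c, x = \sum_A c A *: blade A.
Proof. by exists (coef^~ x); exact: cliffordE. Qed.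

Fact clmul_linearl y : linear (clmul^~ y).
Proof.
move=> a u v; rewrite /clmul scaler_sumr -big_split; apply: eq_bigr => A _.
rewrite scaler_sumr -big_split; apply: eq_bigr => B _ /=.
by rewrite linearP /= scalerA -scalerDl !mulrDl !mulrA.
Qed.

Fact clmul_linearr x : linear (clmul x).
Proof.
move=> a u v; rewrite /clmul scaler_sumr -big_split; apply: eq_bigr => A _.
rewrite scaler_sumr -big_split; apply: eq_bigr => B _ /=.
by rewrite linearP /= scalerA -scalerDl mulrDr mulrDl !mulrA (mulrC a).
Qed.

HB.instance Definition _ x :=
  GRing.isLinear.Build R Cl Cl *:%R (clmul x) (clmul_linearr x).

Let clmulr y x := clmul x y.
HB.instance Definition _ y :=
  GRing.isLinear.Build R Cl Cl *:%R (clmulr y) (clmul_linearl y).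

Fact clmulDl : left_distributive clmul +%R.
Proof. by move=> x y z; apply: (raddfD (clmulr z)). Qed.

Fact clmulDr : right_distributive clmul +%R.
Proof. by move=> x y z; apply: raddfD. Qed.

Fact clscalerAl a x y : a *: clmul x y = clmul (a *: x) y.
Proof. by rewrite -[RHS]/(clmulr y (a *: x)) linearZ. Qed.

Fact clscalerAr a x y : a *: clmul x y = clmul x (a *: y).
Proof. by rewrite linearZ. Qed.

Fact clmul_blade A B :
  clmul (blade A) (blade B) = csign R A B *: blade (symdiff A B).
Proof.
rewrite /clmul (bigD1 A) //= [X in _ + X]big1 ?addr0; last first.
  move=> A' nA; apply: big1 => B' _.
  by rewrite coef_blade (negPf nA) !mul0r scale0r.
rewrite (bigD1 B) //= [X in _ + X]big1 ?addr0; last first.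
  by move=> B' nB; rewrite !coef_blade (negPf nB) mulr0 mul0r scale0r.
by rewrite !coef_blade !eqxx !mul1r.
Qed.

Fact clmulA : associative clmul.
Proof.
move=> x y z.
have suml (I : Type) (r : seq I) F u :
    clmul (\sum_(i <- r) F i) u = \sum_(i <- r) clmul (F i) u.
  exact: (raddf_sum (clmulr u)).
have sumr (I : Type) (r : seq I) F u :
    clmul u (\sum_(i <- r) F i) = \sum_(i <- r) clmul u (F i).
  exact: (raddf_sum (clmul u)).
move: clmul suml sumr clscalerAl clscalerAr clmul_blade => mul suml sumr sAl sAr mb.
have [a ->] := clifford_ex x; rewrite !suml; apply: eq_bigr => A _.
have [b ->] := clifford_ex y; rewrite !(sumr, suml); apply: eq_bigr => B _.
have [c ->] := clifford_ex z; rewrite !sumr; apply: eq_bigr => C _.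
rewrite -!(sAl, sAr) !mb -!(sAl, sAr) !mb !scalerA symdiffA csignDl csignDr.
by congr (_ *: _); ring.
Qed.

Fact clmul1l : left_id (blade set0) clmul.
Proof.
move=> x; have [a ->] := clifford_ex x; rewrite raddf_sum.
apply: eq_bigr => A _ /=.
by rewrite linearZ /= clmul_blade csign0s scale1r symdiff0s.
Qed.

Fact clmul1r : right_id (blade set0) clmul.
Proof.
move=> x; rewrite -[LHS]/(clmulr (blade set0) x).
have [a ->] := clifford_ex x; rewrite raddf_sum.
apply: eq_bigr => A _ /=.
by rewrite linearZ /= /clmulr clmul_blade csigns0 scale1r symdiffs0.
Qed.

Fact blade0_neq0 : blade set0 != 0.
Proof.
apply/eqP => /(congr1 (coef set0)); rewrite coef_blade eqxx raddf0.
by apply/eqP; exact: oner_neq0.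
Qed.

HB.instance Definition _ := GRing.Zmodule_isNzRing.Build Cl
  clmulA clmul1l clmul1r clmulDl clmulDr blade0_neq0.

HB.instance Definition _ := GRing.Lmodule_isLalgebra.Build R Cl clscalerAl.

HB.instance Definition _ := GRing.Lalgebra_isAlgebra.Build R Cl clscalerAr.

Lemma blade0 : blade set0 = 1.
Proof. by []. Qed.

Lemma bladeM A B : blade A * blade B = csign R A B *: blade (symdiff A B).
Proof. exact: clmul_blade. Qed.

Lemma csign1 (i j : 'I_m) : csign R [set i] [set j] = (-1) ^+ (j <= i)%N.
Proof. by rewrite /csign !big_set1. Qed.

Lemma gen_sqr i : gen i * gen i = -1.
Proof. by rewrite bladeM csign1 leqnn symdiffss expr1 scaleN1r. Qed.

Lemma gen_anticomm i j : i != j -> gen i * gen j = - (gen j * gen i).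
Proof.
rewrite !bladeM !csign1 symdiffC -scaleNr => nij; congr (_ *: _).
case: (ltngtP i j) => [_|_|/val_inj/eqP]; last by rewrite (negPf nij).
  by rewrite expr0 expr1 opprK.
by rewrite expr1 expr0.
Qed.

Lemma blade_prod A : blade A = \prod_(i <- enum A) gen i.
Proof.
have: sorted ltn (map val (enum A)).
  apply: (subseq_sorted ltn_trans (s2 := iota 0 m)); last exact: iota_ltn_sorted.
  rewrite -val_enum_ord; apply: map_subseq.
  by rewrite enumT; apply: filter_subseq.
rewrite -[in LHS](set_enum A); elim: (enum A) => [_|i s IHs] /=.
  by rewrite big_nil -blade0; congr blade; apply/setP=> i; rewrite !inE.
rewrite (path_sortedE ltn_trans) big_cons => /andP[/allP lt_i /IHs <-].
rewrite bladeM /csign big_set1 big1 ?expr0 ?scale1r; last first.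
  by move=> j; rewrite inE => js; rewrite leqNgt lt_i ?map_f.
congr blade; apply/setP=> j; rewrite !inE; case: eqP => [->|//] /=.
by apply/esym/negP => /(map_f val)/lt_i /=; rewrite ltnn.
Qed.

Fact clconj_is_linear : linear clconj.
Proof.
move=> a u v; rewrite /clconj scaler_sumr -big_split; apply: eq_bigr => A _ /=.
by rewrite linearP /= scalerA -scalerDl mulrDl mulrA.
Qed.

HB.instance Definition _ :=
  GRing.isLinear.Build R Cl Cl *:%R clconj clconj_is_linear.

Lemma coef_conj A x : coef A (clconj x) = coef A x * csign R A A.
Proof.
rewrite /clconj raddf_sum (bigD1 A) //= big1 ?addr0.
  by rewrite linearZ /= coef_blade eqxx mulr1.
by move=> B; rewrite linearZ /= coef_blade eq_sym => /negPf->; rewrite mulr0.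
Qed.

Lemma clconj_blade A : clconj (blade A) = csign R A A *: blade A.
Proof.
apply/cliffordP => B; rewrite coef_conj linearZ /= coef_blade mulrC.
by case: eqP => [->//|]; rewrite !mulr0.
Qed.

Lemma clconj_gen i : clconj (gen i) = - gen i.
Proof. by rewrite clconj_blade csign1 leqnn expr1 scaleN1r. Qed.

Lemma clconjK : involutive clconj.
Proof.
by move=> x; apply/cliffordP => A; rewrite !coef_conj -mulrA csignK mulr1.
Qed.

Lemma clconjM x y : clconj (x * y) = clconj y * clconj x.
Proof.
have conjZ c u : clconj (c *: u) = c *: clconj u by rewrite linearZ.
have [a ->] := clifford_ex x; have [b ->] := clifford_ex y.
rewrite mulr_suml !raddf_sum mulr_sumr; apply: eq_bigr => A _.
rewrite mulr_sumr !raddf_sum mulr_suml; apply: eq_bigr => B _ /=.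
rewrite -!(scalerAl, scalerAr) !conjZ -!(scalerAl, scalerAr) bladeM conjZ.
rewrite !clconj_blade -!(scalerAl, scalerAr) bladeM !scalerA (symdiffC B A).
congr (_ *: _); rewrite csignDl !csignDr -[RHS]mulr1 -(csignK R A B); ring.
Qed.

Definition evencl : {pred Cl} :=
  [pred x | [forall A : {set 'I_m}, odd #|A| ==> (coef A x == 0)]].

Lemma evenclP x :
  reflect (forall A, odd #|A| -> coef A x = 0) (x \in evencl).
Proof.
apply: (iffP forallP) => [h A oA|h A]; first by have /implyP/(_ oA)/eqP := h A.
by apply/implyP => /h->.
Qed.

Lemma odd_symdiff A B : odd #|symdiff A B| = odd #|A| (+) odd #|B|.
Proof.
have cardE (D : {set 'I_m}) : odd #|D| = \big[addb/false]_(i : 'I_m) (i \in D).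
  rewrite -sum1_card big_mkcond /= (big_morph odd oddD (erefl (odd 0))).
  by apply: eq_bigr => i _; case: ifP.
by rewrite !cardE -big_split; apply: eq_bigr => i _; rewrite inE.
Qed.

Lemma evencl_blade A : (blade A \in evencl) = ~~ odd #|A|.
Proof.
apply/evenclP/idP => [h|eA B oB].
  apply/negP => /h; rewrite coef_blade eqxx; apply/eqP; exact: oner_neq0.
by rewrite coef_blade; case: eqP => [e|//]; rewrite e (negPf eA) in oB.
Qed.

Fact evencl_subalg : GRing.subalg_closed evencl.
Proof.
have lin : GRing.linear_closed evencl.
  move=> a x y /evenclP ex /evenclP ey; apply/evenclP => A oA.
  by rewrite linearP /= ex // ey // mulr0 addr0.
have ev0 : 0 \in evencl by apply/evenclP => A _; rewrite raddf0.
split=> //; first by rewrite -blade0 evencl_blade cards0.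
move=> x y /evenclP ex /evenclP ey; apply/evenclP => C oC.
rewrite -[x * y]/(clmul x y) /clmul raddf_sum big1 // => A _ /=.
rewrite raddf_sum big1 // => B _ /=; rewrite linearZ /= coef_blade.
case: eqP => [eC|_]; last by rewrite mulr0.
move: oC; rewrite eC odd_symdiff.
by case oA: (odd #|A|) => /=; [rewrite ex | move=> oB; rewrite [coef B y]ey];
  rewrite ?(mulr0, mul0r).
Qed.

HB.instance Definition _ :=
  GRing.isSubalgClosed.Build R Cl evencl evencl_subalg.

End Clifford.

(* The even subalgebra R_m^+. *)
Record even_clifford (R : comNzRingType) (m : nat) : Type := EvenClifford
  { even_val : clifford R m; even_valP : even_val \in @evencl R m }.

HB.instance Definition _ (R : comNzRingType) (m : nat) :=
  [isSub for @even_val R m].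
HB.instance Definition _ (R : comNzRingType) (m : nat) :=
  [Choice of even_clifford R m by <:].
HB.instance Definition _ (R : comNzRingType) (m : nat) :=
  [SubChoice_isSubAlgebra of even_clifford R m by <:].

Section EvenClifford.
Variables (R : comNzRingType) (m : nat).

Fact evencl_conj (x : even_clifford R m) : clconj (even_val x) \in @evencl R m.
Proof.
by apply/evenclP => A oA; rewrite coef_conj (evenclP _ (even_valP x)) ?mul0r.
Qed.

Definition even_conj (x : even_clifford R m) : even_clifford R m :=
  EvenClifford (evencl_conj x).

Lemma even_conjM x y : even_conj (x * y) = even_conj y * even_conj x.
Proof. by apply/val_inj; rewrite /= clconjM. Qed.

Fact evencl_gen2 (i j : 'I_m) : gen R i * gen R j \in @evencl R m.
Proof.
by rewrite bladeM rpredZ // evencl_blade odd_symdiff !cards1.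
Qed.

Definition gen2 (i j : 'I_m) : even_clifford R m :=
  EvenClifford (evencl_gen2 i j).

Lemma val_gen2 (i j : 'I_m) : (i < j)%N -> even_val (gen2 i j) = blade R [set i; j].
Proof.
move=> ij; rewrite /= bladeM csign1 leqNgt ij scale1r; congr blade.
by apply/setP=> l; rewrite !inE; case: eqP => // ->; rewrite -val_eqE (ltn_eqF ij).
Qed.

Definition dot (x y : 'rV[R]_m) : R := \sum_j x 0 j * y 0 j.

Definition wedge (x y : 'rV[R]_m) : even_clifford R m :=
  \sum_(i < m) \sum_(j < m | (i < j)%N)
    (x 0 i * y 0 j - x 0 j * y 0 i) *: gen2 i j.

Definition unit_sphere : {pred 'rV[R]_m} := [pred x | dot x x == 1].

End EvenClifford.

Section Tau.
Variable R : comNzRingType.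
Local Notation e := (@gen R 2).
Local Notation e_ := (@gen2 R 3).
Local Notation co x A := (coef A (even_val x)).

Definition tau (x : even_clifford R 3) : clifford R 2 :=
  co x set0 *: 1 + co x [set 0; 1] *: (e 0 * e 1)
    + co x [set 0; 2] *: e 1 - co x [set 1; 2] *: e 0.

Definition tau_inv (y : clifford R 2) : even_clifford R 3 :=
  coef set0 y *: 1 + coef [set 0; 1] y *: e_ 0 1
    + coef [set 1] y *: e_ 0 2 - coef [set 0] y *: e_ 1 2.

Lemma gen01 : e 0 * e 1 = blade R [set 0; 1].
Proof. exact: (@val_gen2 R 2 0 1). Qed.

Lemma clifford2P (x y : clifford R 2) :
    coef set0 x = coef set0 y -> coef [set 0] x = coef [set 0] y ->
    coef [set 1] x = coef [set 1] y -> coef [set 0; 1] x = coef [set 0; 1] y ->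
  x = y.
Proof.
move=> h h0 h1 h01; apply/cliffordP => A.
have eA (B : {set 'I_2}) :
    ((0 : 'I_2) \in A) = (0 \in B) -> ((1 : 'I_2) \in A) = (1 \in B) -> A = B.
  move=> A0 A1; apply/setP => -[[|[|//]] p].
    by rewrite (_ : Ordinal p = 0) //; apply: val_inj.
  by rewrite (_ : Ordinal p = 1) //; apply: val_inj.
case A0: ((0 : 'I_2) \in A); case A1: ((1 : 'I_2) \in A).
- by rewrite (eA [set 0; 1]) // !inE.
- by rewrite (eA [set 0]) // !inE.
- by rewrite (eA [set 1]) // !inE.
- by rewrite (eA set0) // !inE.
Qed.

Lemma even3P (x y : even_clifford R 3) :
    co x set0 = co y set0 -> co x [set 0; 1] = co y [set 0; 1] ->
    co x [set 0; 2] = co y [set 0; 2] -> co x [set 1; 2] = co y [set 1; 2] ->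
  x = y.
Proof.
move=> h h01 h02 h12; apply/val_inj/cliffordP => A /=.
case oA: (odd #|A|); first by rewrite !(evenclP _ (even_valP _)).
have eA (B : {set 'I_3}) : [/\ ((0 : 'I_3) \in A) = (0 \in B),
    ((1 : 'I_3) \in A) = (1 \in B) & ((2 : 'I_3) \in A) = (2 \in B)] -> A = B.
  case=> A0 A1 A2; apply/setP => -[[|[|[|//]]] p].
  - by rewrite (_ : Ordinal p = 0) //; apply: val_inj.
  - by rewrite (_ : Ordinal p = 1) //; apply: val_inj.
  - by rewrite (_ : Ordinal p = 2) //; apply: val_inj.
have: odd #|A| = odd (\sum_(i < 3) (i \in A)).
  by rewrite -sum1_card big_mkcond; congr odd; apply: eq_bigr => i _; case: ifP.
rewrite oA !big_ord_recl big_ord0.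
have -> : lift ord0 (lift ord0 ord0) = 2 :> 'I_3 by apply: val_inj.
have -> : lift ord0 ord0 = 1 :> 'I_3 by apply: val_inj.
case A0: (0 \in A); case A1: (1 \in A); case A2: (2 \in A) => // _.
- by rewrite (eA [set 0; 1]) // A0 A1 A2 !inE.
- by rewrite (eA [set 0; 2]) // A0 A1 A2 !inE.
- by rewrite (eA [set 1; 2]) // A0 A1 A2 !inE.
- by rewrite (eA set0) // A0 A1 A2 !inE.
Qed.


Let neqs (n : nat) (A B : {set 'I_n}) i : (i \in A) != (i \in B) -> (A == B) = false.
Proof. by apply: contraNF => /eqP->. Qed.

Let neq2 : ((set0 == [set 0] :> {set 'I_2}) = false)
  * ((set0 == [set 1] :> {set 'I_2}) = false)
  * ((set0 == [set 0; 1] :> {set 'I_2}) = false)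
  * (([set 0] == set0 :> {set 'I_2}) = false)
  * (([set 0] == [set 1] :> {set 'I_2}) = false)
  * (([set 0] == [set 0; 1] :> {set 'I_2}) = false)
  * (([set 1] == set0 :> {set 'I_2}) = false)
  * (([set 1] == [set 0] :> {set 'I_2}) = false)
  * (([set 1] == [set 0; 1] :> {set 'I_2}) = false)
  * (([set 0; 1] == set0 :> {set 'I_2}) = false)
  * (([set 0; 1] == [set 0] :> {set 'I_2}) = false)
  * (([set 0; 1] == [set 1] :> {set 'I_2}) = false).
Proof.
by do !split; (apply: (@neqs _ _ _ 0); rewrite !inE; done)
           || (apply: (@neqs _ _ _ 1); rewrite !inE; done).
Qed.

Let neq3 : ((set0 == [set 0; 1] :> {set 'I_3}) = false)
  * ((set0 == [set 0; 2] :> {set 'I_3}) = false)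
  * ((set0 == [set 1; 2] :> {set 'I_3}) = false)
  * (([set 0; 1] == set0 :> {set 'I_3}) = false)
  * (([set 0; 1] == [set 0; 2] :> {set 'I_3}) = false)
  * (([set 0; 1] == [set 1; 2] :> {set 'I_3}) = false)
  * (([set 0; 2] == set0 :> {set 'I_3}) = false)
  * (([set 0; 2] == [set 0; 1] :> {set 'I_3}) = false)
  * (([set 0; 2] == [set 1; 2] :> {set 'I_3}) = false)
  * (([set 1; 2] == set0 :> {set 'I_3}) = false)
  * (([set 1; 2] == [set 0; 1] :> {set 'I_3}) = false)
  * (([set 1; 2] == [set 0; 2] :> {set 'I_3}) = false).
Proof.
by do !split; (apply: (@neqs _ _ _ 0); rewrite !inE; done)
           || (apply: (@neqs _ _ _ 1); rewrite !inE; done).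
Qed.

Lemma coef_quat (a b c d : R) (q := a *: 1 + d *: (e 0 * e 1) + c *: e 1 + b *: e 0) :
  [/\ coef set0 q = a, coef [set 0] q = b, coef [set 1] q = c
    & coef [set 0; 1] q = d].
Proof.
by split; rewrite /q gen01 -blade0 !linearD /= !linearZ /= !coef_blade
  ?eqxx ?neq2 ?(mulr0, mulr1, addr0, add0r).
Qed.

Lemma coef_even3 (a b c d : R)
    (x := a *: 1 + b *: e_ 0 1 + c *: e_ 0 2 + d *: e_ 1 2) :
  [/\ co x set0 = a, co x [set 0; 1] = b, co x [set 0; 2] = c
    & co x [set 1; 2] = d].
Proof.
have -> : even_val x = a *: blade R set0 + b *: blade R [set 0; 1]
    + c *: blade R [set 0; 2] + d *: blade R [set 1; 2].
  by rewrite -!val_gen2.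
by split; rewrite !linearD /= !linearZ /= !coef_blade
  ?eqxx ?neq3 ?(mulr0, mulr1, addr0, add0r).
Qed.

Lemma even3E (x : even_clifford R 3) :
  x = co x set0 *: 1 + co x [set 0; 1] *: e_ 0 1 + co x [set 0; 2] *: e_ 0 2
    + co x [set 1; 2] *: e_ 1 2.
Proof.
have [h h01 h02 h12] :=
  coef_even3 (co x set0) (co x [set 0; 1]) (co x [set 0; 2]) (co x [set 1; 2]).
by apply: even3P.
Qed.

Lemma quatE (q : clifford R 2) :
  q = coef set0 q *: 1 + coef [set 0; 1] q *: (e 0 * e 1)
    + coef [set 1] q *: e 1 + coef [set 0] q *: e 0.
Proof.
have [h h0 h1 h01] :=
  coef_quat (coef set0 q) (coef [set 0] q) (coef [set 1] q) (coef [set 0; 1] q).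
by apply: clifford2P.
Qed.

Lemma tauK : cancel tau tau_inv.
Proof.
move=> x; rewrite /tau -scaleNr /tau_inv -scaleNr.
have [-> -> -> ->] := coef_quat (co x set0) (- co x [set 1; 2])
  (co x [set 0; 2]) (co x [set 0; 1]).
by rewrite opprK -even3E.
Qed.

Lemma tau_invK : cancel tau_inv tau.
Proof.
move=> y; rewrite /tau_inv -scaleNr /tau -scaleNr.
have [-> -> -> ->] := coef_even3 (coef set0 y) (coef [set 0; 1] y)
  (coef [set 1] y) (- coef [set 0] y).
by rewrite opprK -quatE.
Qed.

End Tau.

Section ComplexAdjoint.
Variable R : realType.
Local Notation C := R[i].
Local Notation H := (clifford R 2).
Local Notation e1 := (gen R (0 : 'I_2)).
Local Notation e2 := (gen R (1 : 'I_2)).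

(* The isomorphism of C with H_e = span{1, e_12}, i |-> e_12. *)
Definition ofC (z : C) : H := complex.Re z *: 1 + complex.Im z *: (e1 * e2).

(* The parts b1, b2 of b = b1 + b2 e_2; note that e_12 e_2 = - e_1. *)
Definition part1 (b : H) : C := Complex (coef set0 b) (coef [set 0; 1] b).
Definition part2 (b : H) : C := Complex (coef [set 1] b) (- coef [set 0] b).

Lemma partsP (b : H) (z w : C) :
  b = ofC z + ofC w * e2 <-> z = part1 b /\ w = part2 b.
Proof.
have E (a b' c d : R) : ofC (Complex a b') + ofC (Complex c d) * e2
    = a *: 1 + b' *: (e1 * e2) + c *: e2 + (- d) *: e1.
  rewrite /ofC /= mulrDl -!scalerAl mul1r -mulrA gen_sqr mulrN1 scalerN scaleNr.
  by rewrite !addrA.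
case: z w => [z1 z2] [w1 w2]; rewrite E; split.
  by move=> ->; rewrite /part1 /part2;
    have [-> -> -> ->] := coef_quat z1 (- w2) w1 z2; rewrite opprK.
by case=> -[-> ->] [-> ->]; rewrite opprK -quatE.
Qed.

Definition chi n (B : 'M[H]_n) : 'M[C]_(n + n) :=
  let B1 := map_mx part1 B in
  let B2 := map_mx part2 B in
  block_mx B1 B2 (- map_mx Num.conj B2) (map_mx Num.conj B1).

Lemma chi_inj n : injective (@chi n).
Proof.
move=> A B /eq_block_mx[/matrixP h1 /matrixP h2 _ _]; apply/matrixP=> i j.
have := h1 i j; have := h2 i j; rewrite !mxE => p2 p1.
have -> : A i j = ofC (part1 (B i j)) + ofC (part2 (B i j)) * e2.
  by apply/(partsP (A i j)).
by apply: esym; apply/(partsP (B i j)).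
Qed.

(* Off the image of chi the value is the junk 0. *)
Definition chi_inv n (M : 'M[C]_(n + n)) : 'M[H]_n :=
  classical_sets.xget 0 (fun B => chi B = M).

Lemma chiK n : cancel (@chi n) (@chi_inv n).
Proof.
move=> B; rewrite /chi_inv; apply: (@chi_inj n).
exact: (@classical_sets.xgetPex _ _ (fun A => chi A = chi B) (ex_intro _ B erefl)).
Qed.

Definition is_psqrt n (M S : 'M[C]_n) : Prop :=
  [/\ S ^t* = S, forall v : 'cV[C]_n, 0 <= (v ^t* *m S *m v) 0 0
    & S *m S = M].

(* The positive square root; 0 if M has none. *)
Definition psqrt n (M : 'M[C]_n) : 'M[C]_n :=
  classical_sets.xget 0 (is_psqrt M).

End ComplexAdjoint.

(* C_n^mu, by its explicit formula
   sum_l (-1)^l (mu)_(n-l) / (l! (n-2l)!) (2x)^(n-2l), (mu)_j rising. *)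
Definition gegenbauer (R : realType) (n : nat) (mu : R) : {poly R} :=
  \sum_(l < n./2.+1)
    ((-1) ^+ l * (\prod_(i < n - l) (mu + i%:R)) / (l`! * (n - l.*2)`!)%N%:R)
      *: (2 *: 'X) ^+ (n - l.*2).

(* Positive definiteness with respect to the involution conj; the 1 x 1 matrix
   a^* B a is required to be a positive real multiple of the unit of T. *)
Definition posdef (R : realType) (T : lalgType R) (conj : T -> T) (n : nat)
    (B : 'M[T]_n) : Prop :=
  B ^t conj = B /\
  forall a : 'cV[T]_n, a != 0 ->
    exists2 r : R, 0 < r & a ^t conj *m B *m a = (r%:A)%:M.

(* Main.v *)
(** [M = chi (tau G)] is a positive definite Hermitian matrix, so it has exactly
    one positive square root [S]. The image of [chi] consists of the matrices [X]
    with [conj X * J = J * X], where [J = [0, 1; -1, 0]]; since [M] has this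
    symmetry, so does [S] by uniqueness, and hence [S^-1]. So [S^-1 = chi (tau A)],
    and [chi (tau (A^* G A))] is [S^-1 S^2 S^-1 = 1]; now [tau] and [chi] are
    injective *-morphisms. *)

Require Import Defs.
From HB Require Import structures.
From mathcomp Require Import all_boot all_order all_algebra.
From mathcomp Require Import ring.
From mathcomp Require Import sesquilinear spectral complex reals.
Import Order.TTheory GRing.Theory Num.Theory.
Local Open Scope ring_scope.
Local Open Scope sesquilinear_scope.

(** * Positive square roots of complex matrices *)

Section PositiveMatrices.
Variable C : numClosedFieldType.

Lemma trmxC_mul m n p (A : 'M[C]_(m, n)) (B : 'M[C]_(n, p)) :
  (A *m B) ^t* = B ^t* *m A ^t*.
Proof. by rewrite trmx_mul map_mxM. Qed.

(** The diagonal entries of X^* S X are the values of the form of S at the columns of X, so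
    positivity of the form passes to the trace. *)
Lemma mxtrace_form m n (S : 'M[C]_m) (X : 'M[C]_(m, n)) :
  \tr (X ^t* *m S *m X) = \sum_j ((col j X) ^t* *m S *m col j X) 0 0.
Proof.
apply: eq_bigr => j _.
have -> : (col j X) ^t* = row j (X ^t*) by apply/matrixP => a b; rewrite !mxE.
by rewrite colE !mulmxA -!row_mul -colE !mxE.
Qed.

(* X = S - T solves the Sylvester equation S X + X T = 0, so the traces of
   X^* S X and X T X^*, both nonnegative, add up to zero. *)
Lemma pos_sqrt_unique n (S T : 'M[C]_n) :
    (forall v : 'cV[C]_n, v != 0 -> 0 < (v ^t* *m S *m v) 0 0) ->
    (forall v : 'cV[C]_n, 0 <= (v ^t* *m T *m v) 0 0) ->
  S *m S = T *m T -> S = T.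
Proof.
move=> S_gt0 T_ge0 eqST.
have S_ge0 (v : 'cV[C]_n) : 0 <= (v ^t* *m S *m v) 0 0.
  have [->|/S_gt0/ltW//] := eqVneq v 0.
  by rewrite mulmx0 mxE.
pose X := S - T.
have sylv : S *m X + X *m T = 0.
  by rewrite mulmxBr mulmxBl addrA subrK eqST subrr.
have tr1 := mxtrace_form _ _ S X.
have tr2 := mxtrace_form _ _ T (X ^t*).
have tr0 : \tr (X ^t* *m S *m X) + \tr ((X ^t*) ^t* *m T *m X ^t*) = 0.
  (* By cyclicity the second trace is that of X^* X T, so the sum is the trace of X^* (S X + X
     T). *)
  rewrite trmxCK [X in _ + X]mxtrace_mulC -mulmxA -mxtraceD -mulmxDr sylv.
  by rewrite mulmx0 mxtrace0.
have ge1 : 0 <= \tr (X ^t* *m S *m X) by rewrite tr1 sumr_ge0.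
have ge2 : 0 <= \tr ((X ^t*) ^t* *m T *m X ^t*) by rewrite tr2 sumr_ge0.
move/eqP: tr0; rewrite paddr_eq0 // => /andP[+ _].
rewrite tr1 psumr_eq0 // => /allP colX0.
apply/eqP; rewrite -subr_eq0; apply/eqP/matrixP => i j; rewrite [RHS]mxE.
suff /colP/(_ i) : col j X = 0 by rewrite !mxE.
apply: contraTeq (colX0 j (mem_index_enum j)) => /S_gt0.
by rewrite implyTb lt0r => /andP[].
Qed.

(** Spectral theorem: M = P^* diag(d) P with P unitary and d > 0, and S = P^* diag(sqrt d) P is the
    root. *)
Lemma pos_sqrt_ex n (M : 'M[C]_n) : M ^t* = M ->
    (forall v : 'cV[C]_n, v != 0 -> 0 < (v ^t* *m M *m v) 0 0) ->
  exists S : 'M[C]_n, [/\ S ^t* = S, S *m S = M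
    & forall v : 'cV[C]_n, v != 0 -> 0 < (v ^t* *m S *m v) 0 0].
Proof.
move=> Mh M_gt0.
have /hermitian_normalmx/orthomx_spectralP : M \is hermsymmx.
  by apply/is_hermitianmxP; rewrite expr0 scale1r Mh.
set P := spectralmx M; set d := spectral_diag M => ME.
have Pu : P \is unitarymx := spectral_unitarymx M.
have PP : P *m P ^t* = 1%:M by apply/unitarymxP.
have PP' : P ^t* *m P = 1%:M by apply: mulmx1C.
rewrite (invmx_unitary Pu) in ME.
have d_gt0 i : 0 < d 0 i.
  have wd : P *m M *m P ^t* = diag_mx d.
    by rewrite ME !mulmxA PP mul1mx -mulmxA PP mulmx1.
  (* The i-th eigenvector, at which the form of M takes the value d_i. *)
  pose v := P ^t* *m delta_mx i (0 : 'I_1).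
  have v0 : v != 0.
    apply/eqP => /(congr1 (mulmx P)); rewrite mulmxA PP mul1mx mulmx0.
    by move/matrixP/(_ i 0)/eqP; rewrite !mxE !eqxx oner_eq0.
  have := M_gt0 v v0; rewrite trmxC_mul trmxCK.
  rewrite !mulmxA -(mulmxA _ P M) -(mulmxA _ (P *m M)) wd -mulmxA -colE.
  rewrite (_ : _ ^t* = delta_mx 0 i) -?rowE ?mxE ?eqxx //.
  by apply/matrixP => a b; rewrite !mxE conjC_nat andbC.
pose D : 'M[C]_n := diag_mx (map_mx sqrtC d).
have Dh : D ^t* = D.
  apply/matrixP => i j; rewrite !mxE eq_sym; case: eqP => [->|_];
    last exact: rmorph0.
  by rewrite !mulr1n geC0_conj // sqrtC_ge0 ltW.
have DD : D *m D = diag_mx d.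
  rewrite mulmx_diag; congr diag_mx; apply/rowP => i; rewrite !mxE.
  by rewrite -expr2 sqrtCK.
exists (P ^t* *m D *m P); split.
- by rewrite !trmxC_mul trmxCK Dh mulmxA.
- by rewrite ME -DD !mulmxA -(mulmxA _ P) PP mulmx1.
move=> v v0; pose w := P *m v.
have w0 : w != 0.
  apply: contraNneq v0 => w0.
  by rewrite -[v]mul1mx -PP' -mulmxA -/w w0 mulmx0.
have -> : v ^t* *m (P ^t* *m D *m P) *m v = w ^t* *m D *m w.
  by rewrite trmxC_mul !mulmxA.
have wE : (w ^t* *m D *m w) 0 0 = \sum_i sqrtC (d 0 i) * `|w i 0| ^+ 2.
  rewrite mxE; apply: eq_bigr => i _; rewrite mul_mx_diag !mxE normCK.
  by ring.
have term_ge0 i : 0 <= sqrtC (d 0 i) * `|w i 0| ^+ 2.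
  by rewrite mulr_ge0 ?exprn_ge0 // sqrtC_ge0 ltW.
rewrite wE lt0r sumr_ge0 // andbT; apply: contra w0.
rewrite psumr_eq0 // => /allP w0; apply/eqP/colP => i.
have := w0 i (mem_index_enum i).
rewrite mulf_eq0 sqrtC_eq0 (gt_eqF (d_gt0 i)) /= sqrf_eq0 normr_eq0 => /eqP->.
by rewrite mxE.
Qed.

(** If u S = 0 then the form vanishes at u^*, which forces u = 0. *)
Lemma posdef_unitmx n (S : 'M[C]_n) :
  (forall v : 'cV[C]_n, v != 0 -> 0 < (v ^t* *m S *m v) 0 0) -> S \in unitmx.
Proof.
move=> S_gt0; rewrite -row_free_unit -kermx_eq0; apply/rowV0P => u.
move=> /sub_kermxP uS; apply/eqP; apply: contraTT isT => u0.
have := S_gt0 (u ^t*); rewrite trmxCK uS mul0mx mxE ltxx; apply.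
by apply: contra u0 => /eqP u0; rewrite -[u]trmxCK u0 trmx0 map_mx0.
Qed.

End PositiveMatrices.

(** * Multiplication tables of R_2 and R_3^+, and [tau] as a *-morphism *)

Section Quaternions.
Variable R : comNzRingType.
Local Notation e := (@gen R 2).
Local Notation e_ := (@gen2 R 3).
Local Notation co x A := (coef A (even_val x)).

(** The quaternion table follows from i^2 = j^2 = -1 and j i = - i j alone. It is read through a
    linear form [f], later a coefficient, and serves both algebras. *)
Lemma scalar_quatM (A : algType R) (f : A -> R) (i j : A)
    (a b c d a' b' c' d' : R) :
    linear_for *%R f -> i * i = -1 -> j * j = -1 -> j * i = - (i * j) ->
  f ((a *: 1 + b *: i + c *: j + d *: (i * j))
     * (a' *: 1 + b' *: i + c' *: j + d' *: (i * j))) =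
    (a * a' - b * b' - c * c' - d * d') * f 1
    + (a * b' + b * a' + c * d' - d * c') * f i
    + (a * c' - b * d' + c * a' + d * b') * f j
    + (a * d' + b * c' - c * b' + d * a') * f (i * j).
Proof.
move=> f_lin ii jj ji.
have fD x y : f (x + y) = f x + f y by rewrite -[x]scale1r f_lin mul1r scale1r.
have f0 : f 0 = 0 by apply: (@addrI _ (f 0)); rewrite -fD !addr0.
have fZ t x : f (t *: x) = t * f x by rewrite -[t *: x]addr0 f_lin f0 addr0.
have fN x : f (- x) = - f x by rewrite -scaleN1r fZ mulN1r.
have ik : i * (i * j) = - j by rewrite mulrA ii mulN1r.
have jk : j * (i * j) = i by rewrite mulrA ji mulNr -mulrA jj mulrN1 opprK.
have ki : i * j * i = j by rewrite -mulrA ji mulrN mulrA ii mulN1r opprK.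
have kj : i * j * j = - i by rewrite -mulrA jj mulrN1.
have kk : i * j * (i * j) = -1 by rewrite mulrA ki jj.
rewrite !mulrDl !mulrDr -!(scalerAl, scalerAr) !(mul1r, mulr1).
rewrite ii jj ji ik jk ki kj kk !fD !fZ !fN.
by ring.
Qed.

(** Here i = e_12, j = e_2 and k = i j = - e_1, whence the sign in [d]. *)
Lemma clifford2_coefM (x y : clifford R 2) :
  let a u := coef set0 u in let b u := coef [set 0; 1] u in
  let c u := coef [set 1] u in let d u := - coef [set 0] u in
  [/\ a (x * y) = a x * a y - b x * b y - c x * c y - d x * d y,
      b (x * y) = a x * b y + b x * a y + c x * d y - d x * c y,
      c (x * y) = a x * c y - b x * d y + c x * a y + d x * b y
    & d (x * y) = a x * d y + b x * c y - c x * b y + d x * a y].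
Proof.
have e01 : e 0 * e 1 = - (e 1 * e 0) by apply: gen_anticomm.
have ii : e 0 * e 1 * (e 0 * e 1) = -1.
  rewrite {1}e01 mulNr mulrA -(mulrA (e 1)) gen_sqr.
  by rewrite mulrN1 mulNr gen_sqr opprK.
have kE : e 0 * e 1 * e 1 = - e 0 by rewrite -mulrA gen_sqr mulrN1.
have ji : e 1 * (e 0 * e 1) = - (e 0 * e 1 * e 1).
  by rewrite mulrA [in RHS]e01 mulNr opprK.
(* The coefficients of 1, e_12, e_2 and e_1, where the form in [scalar_quatM] gets evaluated. *)
have [z1 z2 z3 z4] := coef_quat (1 : R) 0 0 0.
have [i1 i2 i3 i4] := coef_quat (0 : R) 0 0 1.
have [j1 j2 j3 j4] := coef_quat (0 : R) 0 1 0.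
have [k1 k2 k3 k4] := coef_quat (0 : R) 1 0 0.
move: z1 z2 z3 z4 i1 i2 i3 i4 j1 j2 j3 j4 k1 k2 k3 k4.
rewrite !(scale0r, scale1r, addr0, add0r).
move=> z1 z2 z3 z4 i1 i2 i3 i4 j1 j2 j3 j4 k1 k2 k3 k4.
have quatE' u : u = coef set0 u *: 1 + coef [set 0; 1] u *: (e 0 * e 1)
    + coef [set 1] u *: e 1 + - coef [set 0] u *: (e 0 * e 1 * e 1).
  by rewrite kE scaleNr scalerN opprK -quatE.
move=> a b c d.
have M A := scalar_quatM _ (coef A) _ _ (a x) (b x) (c x) (d x)
  (a y) (b y) (c y) (d y) (coef_is_linear A) ii (gen_sqr _ _) ji.
rewrite -!quatE' kE in M.
by split; rewrite 1?[LHS]M 1?[d (x * y)]/d ?M !raddfN /=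
  ?(z1, z2, z3, z4, i1, i2, i3, i4, j1, j2, j3, j4) ?(k1, k2, k3, k4); ring.
Qed.

(** Here i = e_12, j = e_13 and k = i j = e_23; [tau] carries this triple to that of R_2, and the
    two tables coincide. *)
Lemma even_clifford3_coefM (x y : even_clifford R 3) :
  let a u := co u set0 in let b u := co u [set 0; 1] in
  let c u := co u [set 0; 2] in let d u := co u [set 1; 2] in
  [/\ a (x * y) = a x * a y - b x * b y - c x * c y - d x * d y,
      b (x * y) = a x * b y + b x * a y + c x * d y - d x * c y,
      c (x * y) = a x * c y - b x * d y + c x * a y + d x * b y
    & d (x * y) = a x * d y + b x * c y - c x * b y + d x * a y].
Proof.
have anti (i j : 'I_3) : i != j -> gen R i * gen R j = - (gen R j * gen R i).
  exact: gen_anticomm.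
have sqr (i j : 'I_3) : i != j -> e_ i j * e_ i j = -1.
  move=> nij; apply: val_inj; rewrite /= {1}(anti _ _ nij) mulNr mulrA.
  by rewrite -(mulrA (gen R j)) gen_sqr mulrN1 mulNr gen_sqr opprK.
have kE : e_ 0 1 * e_ 0 2 = e_ 1 2.
  apply: val_inj; rewrite /= (anti 0 1) // mulNr mulrA -(mulrA (gen R 1)).
  by rewrite gen_sqr mulrN1 mulNr opprK.
have ji : e_ 0 2 * e_ 0 1 = - (e_ 0 1 * e_ 0 2).
  apply: val_inj; rewrite kE /= (anti 0 2) // mulNr mulrA -(mulrA (gen R 2)).
  by rewrite gen_sqr mulrN1 mulNr opprK (anti 2 1).
have [z1 z2 z3 z4] := coef_even3 (1 : R) 0 0 0.
have [i1 i2 i3 i4] := coef_even3 (0 : R) 1 0 0.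
have [j1 j2 j3 j4] := coef_even3 (0 : R) 0 1 0.
have [k1 k2 k3 k4] := coef_even3 (0 : R) 0 0 1.
move: z1 z2 z3 z4 i1 i2 i3 i4 j1 j2 j3 j4 k1 k2 k3 k4.
rewrite !(scale0r, scale1r, addr0, add0r).
move=> z1 z2 z3 z4 i1 i2 i3 i4 j1 j2 j3 j4 k1 k2 k3 k4.
have lin A : linear_for *%R (fun u : even_clifford R 3 => co u A).
  by move=> t u v; rewrite [even_val _]/= linearP.
move=> a b c d.
have M A := scalar_quatM _ (fun u => co u A) _ _ (a x) (b x) (c x) (d x)
  (a y) (b y) (c y) (d y) (lin A) (sqr 0 1 isT) (sqr 0 2 isT) ji.
rewrite kE -!even3E in M.
by split; rewrite [LHS]M /=
  ?(z1, z2, z3, z4, i1, i2, i3, i4, j1, j2, j3, j4) ?(k1, k2, k3, k4); ring.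
Qed.

Lemma coef_tau (x : even_clifford R 3) :
  [/\ coef set0 (tau x) = co x set0, coef [set 0] (tau x) = - co x [set 1; 2],
      coef [set 1] (tau x) = co x [set 0; 2]
    & coef [set 0; 1] (tau x) = co x [set 0; 1]].
Proof. by rewrite /tau -scaleNr; apply: coef_quat. Qed.

Lemma tauM : {morph @tau R : x y / x * y}.
Proof.
move=> x y; have [p1 p2 p3 p4] := clifford2_coefM (tau x) (tau y).
have [q1 q2 q3 q4] := even_clifford3_coefM x y.
have [xy1 xy2 xy3 xy4] := coef_tau (x * y).
have [x1 x2 x3 x4] := coef_tau x; have [y1 y2 y3 y4] := coef_tau y.
apply: clifford2P; rewrite ?xy1 ?xy2 ?xy3 ?xy4.
- by rewrite p1 q1 x1 x2 x3 x4 y1 y2 y3 y4 !opprK.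
(* The fourth coordinate in R_2 is minus the coefficient of e_1. *)
- by apply: oppr_inj; rewrite p4 q4 x1 x2 x3 x4 y1 y2 y3 y4 !opprK.
- by rewrite p3 q3 x1 x2 x3 x4 y1 y2 y3 y4 !opprK.
- by rewrite p2 q2 x1 x2 x3 x4 y1 y2 y3 y4 !opprK.
Qed.

Lemma tau_linear : linear (@tau R).
Proof.
move=> t x y; have [xy1 xy2 xy3 xy4] := coef_tau (t *: x + y).
have [x1 x2 x3 x4] := coef_tau x; have [y1 y2 y3 y4] := coef_tau y.
by apply: clifford2P; rewrite linearP /= ?xy1 ?xy2 ?xy3 ?xy4 linearP /=
  ?x1 ?x2 ?x3 ?x4 ?y1 ?y2 ?y3 ?y4; ring.
Qed.

Lemma tau1 : tau (1 : even_clifford R 3) = 1.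
Proof.
have [] := coef_even3 (1 : R) 0 0 0.
rewrite !scale0r !addr0 scale1r /tau => -> -> -> ->.
by rewrite !scale0r scale1r !addr0 subr0.
Qed.

(** The sign of conjugation on a bivector: by bimultiplicativity the two squares contribute (-1)^2
    and exactly one of the mixed pairs is a swap. *)
Lemma csign_pair m (i j : 'I_m) : i != j -> csign R [set i; j] [set i; j] = -1.
Proof.
move=> nij; have -> : [set i; j] = symdiff [set i] [set j].
  apply/setP => l; rewrite !inE; case: eqP => [->|//].
  by rewrite (negPf nij).
rewrite csignDl !csignDr !csign1 !leqnn.
by case: (ltngtP i j) => [_|_|/val_inj/eqP]; [ring|ring|rewrite (negPf nij)].
Qed.

Lemma tau_conj (x : even_clifford R 3) : tau (even_conj x) = clconj (tau x).
Proof.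
have [x1 x2 x3 x4] := coef_tau x; have [y1 y2 y3 y4] := coef_tau (even_conj x).
apply: clifford2P; rewrite ?y1 ?y2 ?y3 ?y4 /= !coef_conj ?x1 ?x2 ?x3 ?x4;
  by rewrite ?csign0s ?csign_pair ?csign1 ?leqnn //; ring.
Qed.
End Quaternions.

(** * Transport of matrices and positive definiteness along [tau] *)

HB.instance Definition _ (R : comNzRingType) :=
  GRing.isLinear.Build R (even_clifford R 3) (clifford R 2) *:%R (@tau R)
    (@tau_linear R).
HB.instance Definition _ (R : comNzRingType) :=
  GRing.isMonoidMorphism.Build (even_clifford R 3) (clifford R 2) (@tau R)
    (conj (@tau1 R) (@tauM R)).

Lemma map_tau_trmx (R : comNzRingType) m n (B : 'M[even_clifford R 3]_(m, n)) :
  map_mx (@tau R) (B ^t (@even_conj R 3)) = map_mx (@tau R) B ^t (@clconj R 2).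
Proof. by apply/matrixP => i j; rewrite !mxE tau_conj. Qed.

Lemma map_tauK (R : comNzRingType) m n :
  cancel (map_mx (@tau_inv R)) (@map_mx _ _ (@tau R) m n).
Proof. by move=> B; apply/matrixP => i j; rewrite !mxE tau_invK. Qed.

Lemma map_tau_inj (R : comNzRingType) m n : injective (@map_mx _ _ (@tau R) m n).
Proof.
move=> A B /matrixP AB; apply/matrixP => i j; apply: (can_inj (@tauK R)).
by have := AB i j; rewrite !mxE.
Qed.

(** Each test vector over R_2 is the image of one over R_3^+, and [tau] fixes real scalars. *)
Lemma posdef_tau (R : realType) n (G : 'M[even_clifford R 3]_n) :
  posdef (@even_conj R 3) G -> posdef (@clconj R 2) (map_mx (@tau R) G).
Proof.
case=> Gh G_gt0; split; first by rewrite -map_tau_trmx Gh.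
move=> a a0; pose b := map_mx (@tau_inv R) a.
have aE : a = map_mx (@tau R) b by rewrite map_tauK.
have [|r r0 /(congr1 (map_mx (@tau R)))] := G_gt0 b.
  by apply: contraNneq a0 => b0; rewrite aE b0 map_mx0.
have tauA : tau (r%:A : even_clifford R 3) = r%:A by rewrite linearZ rmorph1.
by rewrite !map_mxM map_tau_trmx -aE map_scalar_mx /= tauA; exists r.
Qed.

(** * The complex adjoint as a *-morphism *)

Section ComplexAdjoint.
Variable R : realType.
Local Notation C := R[i].
Local Notation H := (clifford R 2).

(** The rectangular form of [chi], so that column vectors have an adjoint too. *)
Definition cadj m n (B : 'M[H]_(m, n)) : 'M[C]_(m + m, n + n) :=
  let B1 := map_mx (@part1 R) B in
  let B2 := map_mx (@part2 R) B in
  block_mx B1 B2 (- map_mx Num.conj B2) (map_mx Num.conj B1).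

Lemma part1D (x y : H) : part1 (x + y) = part1 x + part1 y.
Proof. by rewrite /part1 !linearD. Qed.

Lemma part2D (x y : H) : part2 (x + y) = part2 x + part2 y.
Proof. by rewrite /part2 !linearD opprD. Qed.

Lemma part1_0 : part1 (0 : H) = 0.
Proof. by rewrite /part1 !linear0. Qed.

Lemma part2_0 : part2 (0 : H) = 0.
Proof. by rewrite /part2 !linear0 oppr0. Qed.

(** The conjugate reflects e_2 z = conj(z) e_2 for z in H_e, and the minus sign e_2^2 = -1. *)
Lemma part1M (x y : H) :
  part1 (x * y) = part1 x * part1 y - part2 x * (part2 y)^*.
Proof.
have [a b c d] := clifford2_coefM _ x y; rewrite /part1 /part2 a b.
by apply/eqP; rewrite eq_complex /=; apply/andP; split; apply/eqP; ring.
Qed.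

Lemma part2M (x y : H) :
  part2 (x * y) = part1 x * part2 y + part2 x * (part1 y)^*.
Proof.
have [a b c d] := clifford2_coefM _ x y; rewrite /part1 /part2 c d.
by apply/eqP; rewrite eq_complex /=; apply/andP; split; apply/eqP; ring.
Qed.

Lemma part1_conj (x : H) : part1 (clconj x) = (part1 x)^*.
Proof.
by rewrite /part1 !coef_conj csign0s csign_pair // mulr1 mulrN1.
Qed.

Lemma part2_conj (x : H) : part2 (clconj x) = - part2 x.
Proof. by rewrite /part2 !coef_conj !csign1 !leqnn !expr1 !mulrN1. Qed.

Lemma part1_scalar (r : R) : part1 (r%:A : H) = Complex r 0.
Proof.
have [] := coef_quat r 0 0 0; rewrite !scale0r !addr0 /part1.
by move=> -> _ _ ->.
Qed.

Lemma part2_scalar (r : R) : part2 (r%:A : H) = 0.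
Proof.
have [] := coef_quat r 0 0 0; rewrite !scale0r !addr0 /part2.
by move=> _ -> -> _; rewrite oppr0.
Qed.

(** The top blocks are [part1M] and [part2M] summed over the inner index; the bottom blocks are
    their conjugates up to sign. *)
Lemma cadjM m n p (A : 'M[H]_(m, n)) (B : 'M[H]_(n, p)) :
  cadj _ _ (A *m B) = cadj _ _ A *m cadj _ _ B.
Proof.
have M1 : map_mx (@part1 R) (A *m B) = map_mx (@part1 R) A *m map_mx (@part1 R) B
    + map_mx (@part2 R) A *m (- map_mx Num.conj (map_mx (@part2 R) B)).
  apply/matrixP => i j; rewrite !mxE (big_morph _ part1D part1_0) -big_split.
  by apply: eq_bigr => l _; rewrite !mxE part1M mulrN.
have M2 : map_mx (@part2 R) (A *m B) = map_mx (@part1 R) A *m map_mx (@part2 R) B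
    + map_mx (@part2 R) A *m map_mx Num.conj (map_mx (@part1 R) B).
  apply/matrixP => i j; rewrite !mxE (big_morph _ part2D part2_0) -big_split.
  by apply: eq_bigr => l _; rewrite !mxE part2M.
rewrite /cadj M1 M2 mulmx_block; congr block_mx.
  by rewrite map_mxD !map_mxM map_mxCK opprD addrC mulmxN mulNmx.
by rewrite map_mxD !map_mxM map_mxN map_mxCK addrC mulmxN mulNmx.
Qed.

Lemma cadj_trmx m n (B : 'M[H]_(m, n)) :
  cadj _ _ (B ^t (@clconj R 2)) = (cadj _ _ B) ^t*.
Proof.
rewrite /cadj tr_block_mx map_block_mx; congr block_mx;
  apply/matrixP => i j; rewrite !mxE ?part1_conj ?part2_conj //.
- by rewrite rmorphN /= conjCK.
- by rewrite rmorphN /= opprK.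
Qed.

Lemma cadj_scalar n (r : R) : cadj n n (r%:A%:M) = (Complex r 0)%:M.
Proof.
rewrite /cadj [RHS]scalar_mx_block; congr block_mx; apply/matrixP => i j;
  rewrite !mxE; case: eqP => _; rewrite ?mulr1n ?mulr0n;
  rewrite ?part1_scalar ?part2_scalar ?part1_0 ?part2_0 ?conjC0 ?oppr0 //.
exact: conjc_real.
Qed.

Lemma chiE n (B : 'M[H]_n) : chi B = cadj _ _ B.
Proof. by []. Qed.

(** The top blocks of an adjoint are arbitrary, since z + w e_2 has parts z and w. *)
Lemma cadj_ofC m n (M1 M2 : 'M[C]_(m, n)) :
  exists B, cadj m n B = block_mx M1 M2 (- map_mx Num.conj M2) (map_mx Num.conj M1).
Proof.
exists (\matrix_(i, j) (ofC (M1 i j) + ofC (M2 i j) * gen R 1)).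
have P i j := (partsP _ (M1 i j) (M2 i j)).1 erefl.
by rewrite /cadj; congr block_mx; apply/matrixP => i j; rewrite !mxE;
  rewrite -?(P i j).1 -?(P i j).2.
Qed.

(** Any complex v is the first column of the adjoint of a quaternionic column a, so v^* chi(B) v is
    the upper left entry of the adjoint of a^* B a, a positive real scalar. *)
Lemma chi_posdef n (B : 'M[H]_n) : posdef (@clconj R 2) B ->
  (chi B) ^t* = chi B /\
  forall v : 'cV[C]_(n + n), v != 0 -> 0 < (v ^t* *m chi B *m v) 0 0.
Proof.
case=> Bh B_gt0; rewrite !chiE -cadj_trmx Bh; split=> // v v0.
(* The first column of the adjoint of a stacks a_1 over - conj(a_2), which dictates both parts. *)
have [a aE] := cadj_ofC _ _ (usubmx v) (- map_mx Num.conj (dsubmx v)).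
have vE : v = lsubmx (cadj _ _ a).
  rewrite aE block_mxEh row_mxKl -[LHS]vsubmxK; congr col_mx.
  by apply/matrixP => i j; rewrite !mxE rmorphN /= conjCK opprK.
have [|r r0 eqr] := B_gt0 a.
  apply: contraNneq v0 => a0; rewrite vE a0; apply/eqP/matrixP => i j.
  rewrite !mxE; case: splitP => l _; rewrite !mxE; case: splitP => l' _;
  by rewrite !mxE ?part1_0 ?part2_0 ?conjC0 ?oppr0.
(* The first basis vector, which selects the first column. *)
pose u : 'cV[C]_(1 + 1) := col_mx 1%:M 0.
have vu : v = cadj _ _ a *m u.
  by rewrite vE -[in RHS](hsubmxK (cadj _ _ a)) mul_row_col mulmx1 mulmx0 addr0.
have -> : v ^t* *m cadj _ _ B *m v = (Complex r 0)%:M.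
  rewrite vu trmxC_mul -cadj_trmx !mulmxA -(mulmxA (u ^t*)) -cadjM.
  rewrite -(mulmxA (u ^t*)) -cadjM eqr cadj_scalar mul_mx_scalar -scalemxAl.
  rewrite tr_col_mx map_row_mx mul_row_col mulmx0 addr0 mulmx1.
  by rewrite trmx1 map_mx1 scale_scalar_mx mulr1.
by rewrite mxE eqxx mulr1n ltcR.
Qed.

(** * The image of [chi] and the square root inside it *)

Definition cadj_J n : 'M[C]_(n + n) := block_mx 0 1%:M (- 1%:M) 0.

(** The first block row of the equation prescribes the lower blocks of M as in the definition of
    [chi]; the second block row is its conjugate. *)
Lemma chi_imageP n (M : 'M[C]_(n + n)) :
  (exists B, chi B = M) <-> map_mx Num.conj M *m cadj_J n = cadj_J n *m M.
Proof.
rewrite -[M]submxK map_block_mx !mulmx_block.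
rewrite !(mulmx0, mul0mx, mulmx1, mul1mx, addr0, add0r, mulmxN, mulNmx).
split=> [[B /eq_block_mx[<- <- <- <-]]|/eq_block_mx[e1 e2 _ _]].
  by rewrite map_mxN !map_mxCK.
have [B BE] := cadj_ofC _ _ (ulsubmx M) (ursubmx M).
by exists B; rewrite chiE BE -e1 -e2.
Qed.

(** [psqrt] is a choice with default 0: existence of a root makes the choice a genuine root, and
    uniqueness makes it the invertible one already constructed. *)
Lemma psqrtP n (M : 'M[C]_n) : M ^t* = M ->
    (forall v : 'cV[C]_n, v != 0 -> 0 < (v ^t* *m M *m v) 0 0) ->
  [/\ is_psqrt M (psqrt M), psqrt M \in unitmx
    & forall S, is_psqrt M S -> S = psqrt M].
Proof.
move=> Mh M_gt0; have [S [Sh SS S_gt0]] := pos_sqrt_ex _ _ _ Mh M_gt0.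
have uniq T : is_psqrt M T -> T = S.
  case=> _ T_ge0 TT; apply/esym/pos_sqrt_unique => //.
  by rewrite SS TT.
have SP : is_psqrt M S.
  split=> // v; have [->|/S_gt0/ltW//] := eqVneq v 0.
  by rewrite mulmx0 mxE.
have PP : is_psqrt M (psqrt M).
  exact: (@classical_sets.xgetPex _ _ (is_psqrt M) (ex_intro _ S SP)).
split=> //; last by move=> T /uniq ->; rewrite (uniq _ PP).
by rewrite (uniq _ PP) (posdef_unitmx _ _ _ S_gt0).
Qed.

(* Conjugation by the structure map v |-> J conj(v) fixes M, hence also its
   unique positive square root. *)
Lemma psqrt_chi n (B : 'M[H]_n) : posdef (@clconj R 2) B ->
  exists D : 'M[H]_n, chi D = invmx (psqrt (chi B)).
Proof.
move=> /chi_posdef[Mh M_gt0].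
have [[Sh S_ge0 SS] Su uniq] := psqrtP _ _ Mh M_gt0.
have /chi_imageP MJ : exists B', chi B' = chi B by exists B.
move: (chi B) (psqrt _) Mh M_gt0 Sh S_ge0 SS Su uniq MJ => M S.
move=> Mh M_gt0 Sh S_ge0 SS Su uniq MJ.
pose J := cadj_J n; pose cj (X : 'M[C]_(n + n)) := map_mx Num.conj X.
have Jh : J ^t* = - J.
  rewrite tr_block_mx map_block_mx linearN /= trmx0 trmx1 map_mxN map_mx0.
  by rewrite map_mx1 opp_block_mx oppr0 opprK.
have JJ : J *m J = - 1%:M.
  rewrite mulmx_block !(mulmx0, mul0mx, mulmx1, mul1mx, addr0, add0r).
  by rewrite scalar_mx_block opp_block_mx !oppr0.
(* As J^-1 = - J, this is J conj(S) J^-1. *)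
pose T := - (J *m cj S *m J).
have TS : T = S.
  apply: uniq; split.
  - have cSh : (cj S) ^t* = cj S.
      by rewrite -[in RHS]Sh; apply/matrixP => i j; rewrite !mxE.
    rewrite /T linearN map_mxN !trmxC_mul cSh Jh mulmxN !mulNmx mulmxN.
    by rewrite opprK mulmxA.
  (* The form of T at v is the conjugate of the form of S at w. *)
  - move=> v; pose w := map_mx Num.conj (J *m v).
    have -> : v ^t* *m T *m v = map_mx Num.conj (w ^t* *m S *m w).
      have wK : map_mx Num.conj w = J *m v by rewrite /w map_mxCK.
      have wK' : map_mx Num.conj (w ^t*) = v ^t* *m - J.
        rewrite -Jh -trmxC_mul.
        by apply/matrixP => i j; rewrite !mxE conjCK.
      rewrite !map_mxM wK wK' -/(cj S) /T mulmxN !mulNmx.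
      by rewrite !mulmxA mulmxN !mulNmx.
    by rewrite mxE conjC_ge0.
  (* T^2 = - J conj(M) J = - J J M = M, by the symmetry of M. *)
  rewrite /T mulmxN mulNmx opprK !mulmxA -(mulmxA _ J J) JJ mulmxN mulmx1.
  rewrite !mulNmx -(mulmxA J) -map_mxM SS -/(cj M).
  by rewrite -mulmxA MJ mulmxA JJ mulNmx mul1mx opprK.
have SJ : cj S *m J = J *m S.
  by rewrite -[in RHS]TS /T mulmxN !mulmxA JJ !mulNmx mul1mx opprK.
apply/chi_imageP; rewrite -/J map_invmx -/(cj S).
have cSu : cj S \in unitmx by rewrite map_unitmx.
(* Multiplying on the left by conj(S) reduces the rule for S^-1 to the one for S. *)
apply: (can_inj (mulKmx cSu)); rewrite !mulmxA mulmxV // mul1mx SJ.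
by rewrite -mulmxA mulmxV // mulmx1.
Qed.

End ComplexAdjoint.

(** * Normalization of a positive definite matrix *)

Lemma posdef_psqrt_normalize (R : realType) n (G : 'M[even_clifford R 3]_n) :
  let A := map_mx (@tau_inv R)
    (chi_inv (invmx (psqrt (chi (map_mx (@tau R) G))))) in
  posdef (@even_conj R 3) G -> A ^t (@even_conj R 3) *m G *m A = 1%:M.
Proof.
move=> A /posdef_tau; set B := map_mx (@tau R) G => B_pos.
have [D chiD] := psqrt_chi _ _ _ B_pos.
(* Since S^-1 is in the image of [chi], [chi_inv] returns the true preimage rather than its
   default. *)
have tauA : map_mx (@tau R) A = D by rewrite map_tauK -chiD chiK.
have [Bh B_gt0] := chi_posdef _ _ _ B_pos.
have [[Sh _ SS] Su _] := psqrtP _ _ _ Bh B_gt0.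
apply: map_tau_inj; rewrite !map_mxM map_tau_trmx tauA -/B map_mx1.
apply: chi_inj; rewrite !chiE !cadjM cadj_trmx -!chiE chiD.
(* S^-1 is Hermitian because S is, and the middle factor is expanded as S S. *)
rewrite trmx_inv map_invmx Sh -[X in _ *m X *m _]SS !mulmxA mulVmx // mul1mx.
(* The unit is written as a real multiple of 1 to match [cadj_scalar]. *)
rewrite mulmxV // -[X in _ = chi X%:M](scale1r (1 : clifford R 2)).
by rewrite chiE cadj_scalar.
Qed.

Theorem theorem4p6 (R : realType) (k : nat) (hk : (1 <= k)%N)
    (eta : 'I_k.+1 -> 'rV[R]_3) (heta : forall i, eta i \in @unit_sphere R 3) :
  let G : 'M[even_clifford R 3]_k.+1 :=
    \matrix_(i, j)
      ((k.+1%:R * (gegenbauer k (1 / 2)).[dot (eta i) (eta j)])%:A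
       + (gegenbauer k.-1 (3 / 2)).[dot (eta i) (eta j)]
           *: wedge (eta i) (eta j)) in
  let A : 'M[even_clifford R 3]_k.+1 :=
    map_mx (@tau_inv R)
      (chi_inv (invmx (psqrt (chi (map_mx (@tau R) G))))) in
  posdef (@even_conj R 3) G ->
  A ^t (@even_conj R 3) *m G *m A = 1%:M.
Proof. exact: posdef_psqrt_normalize. Qed.
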